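(* Let $X$ be a finite nonempty set of positive integers and let $\mathcal{G}_X$ be the nim sequence of the all-but subtraction game with finite excluded subtraction set $X$. Fix an integer $k\geq 0$ and let $n=\min\{i\geq 0:\mathcal{G}_X(i)\geq k\}$. Then $\mathcal{G}_X(m)\geq k$ for every $m\geq n+\max(X)$.
   Context: For a finite set $X$ of positive integers, the all-but subtraction game with finite excluded subtraction set $X$ is the subtraction game with subtraction set $S=\{1,2,3,\dots\}\setminus X$: a position is a heap of $n\geq 0$ counters, and a move removes $s$ counters for some $s\in S$ with $s\leq n$. Its nim sequence is defined by $\mathcal{G}_X(n)=\operatorname{mex}\{\mathcal{G}_X(n-s): s\in S,\ s\leq n\}$ for $n\geq 0$, where $\operatorname{mex}$ of a set of nonnegative integers is the least nonnegative integer not in it. *)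

(* Defs.v *)
From mathcomp Require Import all_boot finmap zify.

Set Implicit Arguments.
Unset Strict Implicit.
Unset Printing Implicit Defensive.

Local Open Scope fset_scope.

Lemma mex_subproof (A : {fset nat}) : exists v, v \notin A.
Proof.
exists (\max_(a <- A) a).+1; apply/negP => /= hin.
by have := @leq_bigmax_seq _ (enum_fset A) xpredT id _ hin isT; rewrite ltnn.
Qed.

Definition mex (A : {fset nat}) : nat := ex_minn (mex_subproof A).

Definition allbut (X : {fset nat}) : pred nat :=
  [pred s | (0 < s) && (s \notin X)].

(* The values of the options of the heap of size n, if the heaps of size
   smaller than n have the values given by g. *)
Definition option_values (X : {fset nat}) (g : nat -> nat) (n : nat) :
    {fset nat} :=
  [fset g (n - s) | s in iota 0 n.+1 & allbut X s].

(* The list of the first n terms of the nim sequence, so that the recursion is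
   structural; the defining recurrence is nimE below. *)
Fixpoint nim_prefix (X : {fset nat}) (n : nat) : seq nat :=
  if n is m.+1 then
    let p := nim_prefix X m in rcons p (mex (option_values X (nth 0 p) m))
  else [::].

Definition nim (X : {fset nat}) (n : nat) : nat :=
  nth 0 (nim_prefix X n.+1) n.

Lemma size_nim_prefix X n : size (nim_prefix X n) = n.
Proof. by elim: n => //= n IH; rewrite size_rcons IH. Qed.

Lemma nth_nim_prefix X n i : i < n -> nth 0 (nim_prefix X n) i = nim X i.
Proof.
elim: n => // n IH; rewrite ltnS leq_eqVlt => /orP[/eqP -> //|lt_in].
by rewrite /= nth_rcons size_nim_prefix lt_in IH.
Qed.

Lemma nimE X n : nim X n = mex (option_values X (nim X) n).
Proof.
rewrite {1}/nim /= nth_rcons size_nim_prefix ltnn eqxx; congr mex.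
apply/fsetP => v; apply/imfsetP/imfsetP => -[s /= hs ->]; exists s => //=;
  move: hs; rewrite !inE mem_iota => /and3P[le_sn s0 _];
  rewrite nth_nim_prefix //; lia.
Qed.

Definition fset_max (X : {fset nat}) : nat := \max_(x <- X) x.

Lemma leq_fset_max (X : {fset nat}) x : x \in X -> x <= fset_max X.
Proof. by move=> xX; apply: (@leq_bigmax_seq _ (enum_fset X) xpredT id). Qed.

Lemma nim_unbounded (X : {fset nat}) (k : nat) : exists i, k <= nim X i.
Proof.
pose G (i : 'I_k.+1) := nim X (i * (fset_max X).+1).
have [/existsP[i hi]|/existsPn h] := boolP [exists i, k <= G i].
  by exists (i * (fset_max X).+1).
have hG i : G i < k by rewrite ltnNge; exact: h.
have neqG (i j : 'I_k.+1) : i < j -> G j != G i.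
  move=> lt_ij; rewrite {1}/G nimE /mex; case: ex_minnP => v vP _.
  apply: contraNneq vP => ->; apply/imfsetP.
  have le_d : (fset_max X).+1 <= (j - i) * (fset_max X).+1.
    by rewrite leq_pmull // subn_gt0.
  exists ((j - i) * (fset_max X).+1) => /=; last first.
    by rewrite -mulnBl subKn // ltnW.
  rewrite !inE mem_iota; apply/and3P; split.
  - have: (j - i) * (fset_max X).+1 <= j * (fset_max X).+1.
      by rewrite leq_mul2r leq_subr orbT.
    by move: le_d; set a := (j - i) * _; set b := j * _; lia.
  - exact: leq_trans le_d.
  - by apply/negP => /leq_fset_max; rewrite leqNgt le_d.
have injG : injective (fun i => Ordinal (hG i)).
  move=> i j [eqG]; apply: val_inj => /=; case: (ltngtP i j) => // lt_ij.
    by move: (neqG _ _ lt_ij); rewrite eqG eqxx.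
  by move: (neqG _ _ lt_ij); rewrite eqG eqxx.
by have := leq_card _ injG; rewrite !card_ord ltnn.
Qed.

Definition first_ge (X : {fset nat}) (k : nat) : nat :=
  ex_minn (nim_unbounded X k).

(* Main.v *)
(* Every value below k occurs at some heap i < n, where n is the first heap of
   value at least k, since it is the value of an option of n.  If
   m >= n + max X then m - i > max X, so i is an option of m as well; hence the
   mex defining the value of m is at least k. *)
Require Import Defs.
From mathcomp Require Import all_boot finmap.
From mathcomp Require Import zify.

Lemma mem_lt_mex (A : {fset nat}) v : v < mex A -> v \in A.
Proof.
rewrite /mex; case: ex_minnP => w _ w_min.
by apply: contraTT => /w_min; rewrite -leqNgt.
Qed.

Lemma leq_mex (A : {fset nat}) k :
  (forall v, v < k -> v \in A) -> k <= mex A.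
Proof.
move=> ltkA; rewrite /mex; case: ex_minnP => w wA _.
by rewrite leqNgt; apply: contra wA; apply: ltkA.
Qed.

(** Any value below a mex is attained by some option, and a move removes at least one counter, so
    that option is a strictly smaller heap. *)
Lemma lt_nim_ex X n v : v < nim X n -> exists2 i, i < n & v = nim X i.
Proof.
rewrite nimE => /mem_lt_mex/imfsetP[s /=].
rewrite !inE mem_iota => /and3P[le_sn s_gt0 _] ->.
by exists (n - s) => //; lia.
Qed.

Lemma nim_in_option_values X m i :
  i + fset_max X < m -> nim X i \in option_values X (nim X) m.
Proof.
(* Removing [m - i] counters leads to [i]; this number exceeds every element of [X], so the move is
   allowed. *)
move=> lt_im; apply/imfsetP; exists (m - i) => /=; last by congr nim; lia.
rewrite !inE mem_iota; apply/and3P; split; [lia | lia |].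
by apply/negP => /leq_fset_max; lia.
Qed.

Theorem mainTheorem3 (X : {fset nat}) (X_nonempty : X <> fset0)
    (X_pos : forall x : nat, x \in X -> 0 < x) (k m : nat) :
  first_ge X k + fset_max X <= m -> k <= nim X m.
Proof.
rewrite /first_ge; case: ex_minnP => n le_kn _ le_nm.
rewrite nimE; apply: leq_mex => v lt_vk.
have [i lt_in ->] := @lt_nim_ex X n v (leq_trans lt_vk le_kn).
(* The strict [i < n] turns [n + fset_max X <= m] into the strict bound required. *)
by apply: nim_in_option_values; lia.
Qed.
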